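(* There exists a universal constant $C>0$ such that the following holds. Let $n=n(m)$ be even and $p=p(n)\in(0,1/2]$ with $n\ge C\,m\log m$ and $m=o(np)$, and let $A$ be drawn from the $(m,n,p)$-Bernoulli ensemble. Then $\mathrm{disc}(A)=1$ with high probability, i.e. with probability tending to $1$ as $m\to\infty$.
   Context: For $A\in\mathbb{R}^{m\times n}$, $\mathrm{disc}(A)=\min_{u\in\{-1,+1\}^n}\|Au\|_\infty$. The $(m,n,p)$-Bernoulli ensemble is the law of an $m\times n$ random matrix with i.i.d. Bernoulli$(p)$ entries. Asymptotics are as $m\to\infty$ (hence $n\to\infty$). *)

(* Defs.v *)
From HB Require Import structures.
From mathcomp Require Import all_boot all_order all_algebra.
From mathcomp Require Import all_classical all_reals all_analysis.
Import Order.TTheory GRing.Theory Num.Theory.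
Import numFieldNormedType.Exports.

Set Implicit Arguments.
Unset Strict Implicit.
Unset Printing Implicit Defensive.

Local Open Scope classical_set_scope.
Local Open Scope ring_scope.

(* The colourings u in {-1, +1}^n are indexed by the finite type 'cV[bool]_n,
   with false |-> +1 and true |-> -1. *)
Definition sign_vec (R : realType) (n : nat) (s : 'cV[bool]_n) : 'cV[R]_n :=
  \col_i (-1) ^+ s i 0.

(* The canonical norm on matrices is the largest absolute value of an entry
   (mx_norm), so `|_| on 'cV[R]_m is the sup norm; it is 0 when m = 0. *)
Definition disc (R : realType) (m n : nat) (A : 'M[R]_(m, n)) : R :=
  let f (s : 'cV[bool]_n) : R := `|A *m sign_vec R s| in
  f [arg min_(s < (const_mx false : 'cV[bool]_n)) f s]%O.

Definition mutually_independent (R : realType) (d d' : measure_display)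
    (T : measurableType d) (T' : measurableType d') (P : probability T R)
    (I : finType) (X : I -> {RV P >-> T'}) : Prop :=
  forall (J : {set I}) (B : I -> set T'),
    (forall i, measurable (B i)) ->
    P (\bigcap_(i in [set` J]) (X i @^-1` B i)) =
    (\prod_(i in J) P (X i @^-1` B i))%E.

Definition bernoulli_entries (R : realType) (d : measure_display)
    (T : measurableType d) (P : probability T R) (m n : nat) (p : R)
    (X : 'I_m -> 'I_n -> {RV P >-> bool}) : Prop :=
  (forall i j, distribution P (X i j) =1 bernoulli_prob p) /\
  mutually_independent (fun ij : 'I_m * 'I_n => X ij.1 ij.2).

Definition random_matrix (R : realType) (d : measure_display)
    (T : measurableType d) (P : probability T R) (m n : nat)
    (X : 'I_m -> 'I_n -> {RV P >-> bool}) (w : T) : 'M[R]_(m, n) :=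
  \matrix_(i, j) (X i j w)%:R.

(* Main.v *)
Require Import Defs.
From HB Require Import structures.
From mathcomp Require Import all_boot all_order all_algebra.
From mathcomp Require Import ring lra zify.
From mathcomp Require Import all_classical all_reals all_analysis.
Import Order.TTheory GRing.Theory Num.Theory.
Import numFieldNormedType.Exports.

Local Open Scope classical_set_scope.
Local Open Scope ring_scope.

                                                                                          
                                                                                               
                                                                                                 
                                                                                                
                                                                                 
                                                                                          
                                                                                                   
                                                                                                
                                                                                       
                                                                              
                                                                                   
                                                 

(** Group the n = 2k columns into k pairs and use only colourings that give opposite signs to the
    two columns of a pair. Each row then yields a signed sum of k independent differences of two
    Bernoulli(p) variables: the endpoint of a lazy walk that steps to either side with probability s
    = p(1-p). Let Z ([near_count]) be the sum over these colourings of the product over the rows of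
    a weight 1, 2, 1 on the endpoints -1, 0, 1. If Z is nonzero, some colouring has norm at most 1
    ([norm_le1_of_near]). If some row has an odd sum, every colouring has norm at least 1
    ([norm_ge1_of_odd]), and all rows are even with probability at most (3/4)^m ([even_rows_mass]).

    By Chebyshev, P(Z = 0) is at most E[Z^2]/E[Z]^2 - 1. For two colourings that agree on a pairs
    and differ on b, the two row sums are u+v and u-v, with u and v independent walks of lengths a
    and b. The weight is chosen so that the product of the two weights splits exactly
    ([near_wt_mul]), hence the joint moment of a row is an explicit expression in walks of lengths a
    and b ([pair_near]). What remains is to compare K_a K_b with K_{a+b}^2, where K_l is the return
    probability, of order (4 pi s l)^(-1/2). Instead of a local limit theorem, recurrences for K_l
    and for the gap between the masses at 0 and 1 show that K_l^2 (s(2l+1) - 4) increases once it is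
    nonnegative ([walk_ret_sqr_mono]). With x = (a-b)/k and |x| at most 1/2, a row contributes a
    ratio of at most exp(x^2 + 10/(sk)) ([near_ratio_central]).

    Raised to the power m and averaged over agreement patterns, this gives a Gaussian moment, in
    total exp(O(m/(sk))), which tends to 1 because m = o(np). Patterns with |x| > 1/2 are
    exponentially rare and the ratio there is at most (k+3)^4 per row; the hypothesis n >= C m log m
    lets the rarity beat (k+3)^(4m) ([unbalanced_tail_le]). *)

(** * Return probabilities of the lazy walk on the integers *)

Section LazyWalk.
Context {R : realFieldType}.
Implicit Types (s : R) (l : nat) (k : int) (f : int -> R).

Definition lazy_step s f k : R := (1 - 2 * s) * f k + s * (f (k - 1) + f (k + 1)).

Definition walk_at s l f : int -> R := iter l (lazy_step s) f.

Definition zero_ind k : R := (k == 0)%:R.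

(** The double weight at 0, rather than the indicator of |k| <= 1, is what makes [near_wt_mul] an
    exact identity. *)
Definition near_wt k : R := zero_ind (k - 1) + 2 * zero_ind k + zero_ind (k + 1).

Definition walk_prob s l : int -> R := walk_at s l zero_ind.

                                                                     
                                         
Definition walk_ret s l : R := walk_prob s l 0.

Definition walk_gap s l : R := walk_prob s l 0 - walk_prob s l 1.

Definition walk_near s l : R := walk_at s l near_wt 0.

Lemma walk_probS s l k :
  walk_prob s l.+1 k = (1 - 2 * s) * walk_prob s l k
    + s * (walk_prob s l (k - 1) + walk_prob s l (k + 1)).
Proof. by []. Qed.

Lemma walk_atS s l f k : walk_at s l.+1 f k =
  (1 - 2 * s) * walk_at s l f k + s * (walk_at s l f (k - 1) + walk_at s l f (k + 1)).
Proof. by []. Qed.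

Lemma walk_probN s l k : walk_prob s l (- k) = walk_prob s l k.
Proof.
elim: l k => [|l IH] k; first by rewrite /walk_prob /= /zero_ind oppr_eq0.
rewrite !walk_probS -(IH (k - 1)) -(IH (k + 1)) IH opprB opprD.
by rewrite addrC (addrC 1 (- k)) [X in _ * X]addrC addrC.
Qed.

Lemma walk_near_prob s l k :
  walk_at s l near_wt k =
  walk_prob s l (k - 1) + 2 * walk_prob s l k + walk_prob s l (k + 1).
Proof.
elim: l k => [|l IH] k //.
rewrite walk_atS !IH !walk_probS; ring.
Qed.

Lemma walk_nearE s l : walk_near s l = 4 * walk_ret s l - 2 * walk_gap s l.
Proof.
rewrite /walk_near walk_near_prob sub0r add0r walk_probN /walk_ret /walk_gap; ring.
Qed.

                                                                         
                                                            
(** With phi(z) = 1 - 2s + s(z + 1/z), the walk has generating function phi^l; the identity compares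
    coefficients in z d/dz phi^(l+1) = (l+1) phi^l s (z - 1/z). At k = 1 it closes the recurrence
    for the pair ([walk_ret], [walk_gap]). *)
Lemma walk_prob_deriv s l k :
  k%:~R * walk_prob s l.+1 k =
  l.+1%:R * s * (walk_prob s l (k - 1) - walk_prob s l (k + 1)).
Proof.
elim: l k => [|l IH] k.
  rewrite walk_probS /walk_prob /= /zero_ind !mul1r.
  rewrite subr_eq0 addr_eq0.
  have [->|k0] := eqVneq k 0; first by rewrite mul0r /= subrr mulr0.
  have [->|k1] := eqVneq k 1; first by rewrite /=; ring.
  have [->|k2] := eqVneq k (-1); first by rewrite /=; ring.
  by rewrite !addr0 subr0 !mulr0 addr0 mulr0.
rewrite walk_probS.
have e1 := IH (k - 1); have e2 := IH (k + 1); have e0 := IH k.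
rewrite !rmorphB !rmorphD /= in e1 e2.
transitivity ((1 - 2 * s) * (k%:~R * walk_prob s l.+1 k)
   + s * ((k%:~R - 1) * walk_prob s l.+1 (k - 1))
   + s * ((k%:~R + 1) * walk_prob s l.+1 (k + 1))
   + s * (walk_prob s l.+1 (k - 1) - walk_prob s l.+1 (k + 1))); first by ring.
rewrite e0 e1 e2 -(natr1 l.+1) [in RHS]mulrDl [in RHS]mulrDl mul1r; congr (_ + _).
rewrite !walk_probS !(subrK, addrK); ring.
Qed.

Lemma walk_retS s l : walk_ret s l.+1 = walk_ret s l - 2 * s * walk_gap s l.
Proof.
rewrite /walk_ret /walk_gap walk_probS sub0r add0r walk_probN; ring.
Qed.

Lemma walk_gapS s l :
  l.+2%:R * walk_gap s l.+1 =
  walk_ret s l + (l.+1%:R - 2 * s * (2 * l%:R + 3)) * walk_gap s l.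
Proof.
have e := walk_prob_deriv s l 1; rewrite mul1r subrr in e.
have e1 := walk_probS s l 1; rewrite subrr in e1.
have e0 := walk_retS s l.
rewrite /walk_ret /walk_gap in e0 *.
set K := walk_prob s l 0 in e e0 e1 *; set c := walk_prob s l 1 in e0 e1 *.
set c2 := walk_prob s l (1 + 1) in e e1.
set K' := walk_prob s l.+1 0 in e0 *; set c' := walk_prob s l.+1 1 in e e1 *.
have {c2 e e1} : l.+2%:R * c' = l.+1%:R * (2 * s * K + (1 - 2 * s) * c).
  have -> : l.+2%:R = l.+1%:R + 1 :> R by rewrite natr1.
  by rewrite mulrDl mul1r {2}e e1; ring.
rewrite mulrBr => ->.
rewrite e0 -(natr1 l.+1) -(natr1 l); ring.
Qed.

Lemma walk_ret0 s : walk_ret s 0 = 1. Proof. by []. Qed.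

Lemma walk_gap0 s : walk_gap s 0 = 1.
Proof. by rewrite /walk_gap /walk_prob /= /zero_ind subr0. Qed.

Lemma walk_gap_linear s l : 0 <= s <= 4^-1 ->
  0 <= walk_gap s l /\ walk_gap s l * (1 + s * l%:R) <= walk_ret s l.
Proof.
move=> /andP[s0 s4].
elim: l => [|l [d0 IH]]; first by rewrite walk_gap0 walk_ret0; split; lra.
have eK := walk_retS s l; have ed := walk_gapS s l.
move: eK ed IH d0; set K := walk_ret s l; set K' := walk_ret s l.+1.
set d := walk_gap s l; set d' := walk_gap s l.+1.
have L0 : 0 <= l%:R :> R by [].
rewrite -(natr1 l.+1) -(natr1 l); set L := l%:R : R in L0 *.
move=> -> ed IH d0.
have Lp : 0 < L + 1 + 1 by lra.
have dd : 0 <= s * L * d by rewrite !mulr_ge0.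
split.
  rewrite -(pmulr_rge0 _ Lp) ed.
  have : 0 <= (1 - 4 * s) * (L * d) by rewrite mulr_ge0 ?mulr_ge0 //; lra.
  have : s * d <= 4^-1 * d by rewrite ler_wpM2r.
  lra.
rewrite -(ler_pM2l Lp) mulrA ed.
have sL : 0 <= (L + 1) * (1 - s) by rewrite mulr_ge0; lra.
have := ler_wpM2l sL IH.
have h : 0 <= s * s * ((L + 1) + (L + 1) * (L + 1)) * d.
  by rewrite mulr_ge0 // mulr_ge0 ?mulr_ge0 //; nra.
move=> h2; rewrite -subr_ge0.
have -> : (L + 1 + 1) * (K - 2 * s * d)
      - (K + (L + 1 - 2 * s * (2 * L + 3)) * d) * (1 + s * (L + 1)) =
    ((L + 1) * (1 - s) * K - (L + 1) * (1 - s) * (d * (1 + s * L)))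
      + 3 * (s * s * ((L + 1) + (L + 1) * (L + 1)) * d) by ring.
lra.
Qed.

(** The Gaussian profile predicts a gap of about K/(4sl), so the leading constant 4 is the right
    one, unlike in [walk_gap_linear]. The offset 6s - 8 is the one that appears in the increment
    computed in [walk_ret_sqr_mono]. *)
Lemma walk_gap_sharp s l : 0 <= s <= 4^-1 ->
  walk_gap s l * (4 * s * l%:R + 6 * s - 8) <= walk_ret s l.
Proof.
move=> s01; have /andP[s0 s4] := s01.
elim: l => [|l IH]; first by rewrite walk_gap0 walk_ret0; lra.
have [d'0 lin'] := walk_gap_linear s l.+1 s01.
have [d0 lin] := walk_gap_linear s l s01.
have eK := walk_retS s l; have ed := walk_gapS s l.
move: eK ed IH d0 lin d'0 lin'; set K := walk_ret s l; set K' := walk_ret s l.+1.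
set d := walk_gap s l; set d' := walk_gap s l.+1.
have L0 : 0 <= l%:R :> R by [].
rewrite -(natr1 l.+1) -(natr1 l); set L := l%:R : R in L0 *.
move=> eK ed IH d0 lin d'0 lin'.
(* While sl is small the linear bound is already stronger; once it is not, sl is large enough for
   the remainder 30sL + 78s - 72 of the induction step to be nonnegative. *)
have [small|big] := lerP (4 * s * (L + 1) + 6 * s - 8) (1 + s * (L + 1)).
  by apply: le_trans lin'; rewrite ler_wpM2l.
have Lp : 0 < L + 1 + 1 by lra.
rewrite -(ler_pM2l Lp) mulrA ed eK.
have sL : 0 <= L + 2 - (4 * s * (L + 1) + 6 * s - 8).
  have : 0 <= (1 - 4 * s) * L by rewrite mulr_ge0 //; lra.
  lra.
have := ler_wpM2l sL IH.
have h : 0 <= (30 * (s * L) + 78 * s - 72) * d by rewrite mulr_ge0 //; lra.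
move=> h2; rewrite -subr_ge0.
set g := 4 * s * (L + 1) + 6 * s - 8 in sL h2 *.
have -> : (L + 1 + 1) * (K - 2 * s * d) - (K + (L + 1 - 2 * s * (2 * L + 3)) * d) * g =
    ((L + 2 - g) * K - (L + 2 - g) * (d * (4 * s * L + 6 * s - 8)))
      + (30 * (s * L) + 78 * s - 72) * d
   by rewrite /g; ring.
lra.
Qed.

(** The linear gap bound gives K_{l+1} >= K_l (l+2)/(l+4), and the product telescopes. The bound is
    crude but uniform in s. *)
Lemma walk_ret_lower s l : 0 <= s <= 4^-1 -> 6 / ((l%:R + 2) * (l%:R + 3)) <= walk_ret s l.
Proof.
move=> s01; have /andP[s0 s4] := s01.
elim: l => [|l IH].
  rewrite walk_ret0 !add0r ler_pdivrMr; lra.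
have [d0 lin] := walk_gap_linear s l s01.
rewrite walk_retS.
have L0 : 0 <= l%:R :> R by [].
rewrite -(natr1 l); move: d0 lin IH; set d := walk_gap s l; set K := walk_ret s l.
set L := l%:R : R in L0 *; move=> d0 lin IH.
have h : 2 * s * d * (L + 4) <= 2 * K.
  have : 4 * s * d <= d.
    have : 0 <= (1 - 4 * s) * d by rewrite mulr_ge0 //; lra.
    lra.
  nra.
have k1 : (L + 2) * K <= (L + 4) * (K - 2 * s * d) by lra.
have L2 : 0 < L + 2 by lra. have L4 : 0 < L + 4 by lra. have L3 : 0 < L + 3 by lra.
have -> : 6 / ((L + 1 + 2) * (L + 1 + 3)) = (L + 2) / (L + 4) * (6 / ((L + 2) * (L + 3))).
  by field; rewrite !gt_eqF //; lra.
apply: (@le_trans _ _ ((L + 2) / (L + 4) * K)).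
  by rewrite ler_wpM2l // divr_ge0 // ltW.
rewrite mulrAC ler_pdivrMr //; lra.
Qed.
Lemma walk_ret_gt0 s l : 0 <= s <= 4^-1 -> 0 < walk_ret s l.
Proof.
move=> s01; apply: lt_le_trans (walk_ret_lower s l s01).
by rewrite divr_gt0 ?mulr_gt0 ?ltr_wpDl.
Qed.

(** K_l^2 is asymptotic to 1/(4 pi s l), so K_l^2 times 2sl is nearly constant; the shift by -4
    makes it monotone. The increment is 2sK times the slack in [walk_gap_sharp], plus a nonnegative
    square term. *)
Lemma walk_ret_sqr_mono s a l : 0 < s <= 4^-1 -> (a <= l)%N ->
  4 <= s * (2 * a%:R + 1) ->
  walk_ret s a ^+ 2 * (s * (2 * a%:R + 1) - 4) <=
  walk_ret s l ^+ 2 * (s * (2 * l%:R + 1) - 4).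
Proof.
move=> /andP[s0 s4] al a4; have s01 : 0 <= s <= 4^-1 by rewrite ltW.
elim: l al => [|l IH]; first by rewrite leqn0 => /eqP ->.
rewrite leq_eqVlt => /predU1P[->//|]; rewrite ltnS => al.
apply: le_trans (IH al) _.
have [d0 _] := walk_gap_linear s l s01.
have sh := walk_gap_sharp s l s01.
have K0 := walk_ret_gt0 s l s01.
have aL : 4 <= s * (2 * l%:R + 1).
  by apply: le_trans a4 _; rewrite ler_pM2l // lerD2r ler_pM2l // ler_nat.
rewrite walk_retS -(natr1 l); move: d0 sh K0 aL.
set K := walk_ret s l; set d := walk_gap s l; set L := l%:R : R.
move=> d0 sh K0 aL.
have h1 : 0 <= K * (K - d * (4 * s * L + 6 * s - 8)) by rewrite mulr_ge0 ?subr_ge0 // ltW.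
have h2 : 0 <= s * (d ^+ 2 * (s * (2 * L + 3) - 4)) 
  by apply: mulr_ge0 (ltW s0) _; apply: mulr_ge0 (sqr_ge0 _) _; lra.
have := mulr_ge0 (ltW s0) h1; have := mulr_ge0 (ltW s0) h2.
move=> g1 g2; rewrite -subr_ge0.
have -> : (K - 2 * s * d) ^+ 2 * (s * (2 * (L + 1) + 1) - 4) - K ^+ 2 * (s * (2 * L + 1) - 4) =
    2 * (s * (K * (K - d * (4 * s * L + 6 * s - 8))))
      + 4 * (s * (s * (d ^+ 2 * (s * (2 * L + 3) - 4)))) by ring.
lra.
Qed.

Definition pair_near s a b : R :=
  walk_near s a * walk_ret s b + walk_ret s a * walk_near s b.

Lemma walk_near_le s l : 0 <= s <= 4^-1 -> walk_near s l <= 4 * walk_ret s l.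
Proof. by move=> /(walk_gap_linear s l)[d0 _]; rewrite walk_nearE; lra. Qed.

Lemma walk_near_ge s l : 0 <= s <= 4^-1 -> 2 * walk_ret s l <= walk_near s l.
Proof.
move=> s01; have [d0] := walk_gap_linear s l s01; rewrite walk_nearE.
have : 0 <= walk_gap s l * (s * l%:R) by rewrite !mulr_ge0 //; case/andP: s01.
lra.
Qed.

Lemma walk_ret_le1 s l : 0 <= s <= 4^-1 -> walk_ret s l <= 1.
Proof.
move=> s01; elim: l => [|l IH]; first by rewrite walk_ret0.
rewrite walk_retS; have [d0 _] := walk_gap_linear s l s01.
have /andP[s0 _] := s01.
have := mulr_ge0 s0 d0; lra.
Qed.

Lemma pair_near_le8 s a b : 0 <= s <= 4^-1 ->
  pair_near s a b <= 8 * (walk_ret s a * walk_ret s b).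
Proof.
move=> s01.
have := ler_wpM2r (ltW (walk_ret_gt0 s b s01)) (walk_near_le s a s01).
have := ler_wpM2l (ltW (walk_ret_gt0 s a s01)) (walk_near_le s b s01).
rewrite /pair_near; lra.
Qed.

Lemma pair_near_ge0 s a b : 0 <= s <= 4^-1 -> 0 <= pair_near s a b.
Proof.
move=> s01; have Kp l := walk_ret_gt0 s l s01.
have Hp l : 0 <= walk_near s l.
  by apply: le_trans (walk_near_ge s l s01); rewrite mulr_ge0 // ltW.
by rewrite addr_ge0 // mulr_ge0 // ltW.
Qed.

(** Multiply the monotonicity bounds from a and from b up to a+b: since 2a/N = 1+x and 2b/N = 1-x,
    this gives (K_a K_b)^2 (1 - x^2 - 8 dl) <= 4 K_{a+b}^4. Then [pair_near] is at most 8 K_a K_b,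
    and [walk_near] is almost 4 K_{a+b}. Squares and fourth powers avoid roots. *)
Lemma pair_near_sqr s a b : 0 < s <= 4^-1 ->
    let N : R := (a + b)%:R in let x := (a%:R - b%:R) / N in let dl := (s * N)^-1 in
    N <= 4 * a%:R -> N <= 4 * b%:R -> 32 <= s * N ->
  pair_near s a b ^+ 2 * ((1 - x ^+ 2 - 8 * dl) * (1 - dl / 2) ^+ 4)
   <= walk_near s (a + b) ^+ 4.
Proof.
move=> s01' N x dl Na Nb sN; have /andP[s0 s4] := s01'.
have s01 : 0 <= s <= 4^-1 by rewrite ltW.
have [N0 sN0] : 0 < N /\ 0 < s * N.
  by split; [rewrite -(pmulr_rgt0 _ s0)|]; lra.
have dl0 : 0 < dl by rewrite invr_gt0.
have sd : s * N * dl = 1 by rewrite mulfV // gt_eqF.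
have dl32 : dl <= 32^-1 by rewrite lef_pV2 // posrE.
have Nab : N = a%:R + b%:R by rewrite /N natrD.
have sa : 0 <= s * (4 * a%:R - N) by rewrite mulr_ge0 ?subr_ge0 // ltW.
have sb : 0 <= s * (4 * b%:R - N) by rewrite mulr_ge0 ?subr_ge0 // ltW.
have sS (l : nat) : s * (2 * l%:R + 1) - 4 = s * N * (2 * l%:R / N + (s - 4) * dl).
  transitivity (s * (2 * l%:R) + (s - 4) * (s * N * dl)); first by rewrite sd; ring.
  by field; rewrite -natrD gt_eqF.
have ma := walk_ret_sqr_mono s a (a + b) s01' (leq_addr _ _).
have mb := walk_ret_sqr_mono s b (a + b) s01' (leq_addl _ _).
have {}ma := ma ltac:(lra); have {}mb := mb ltac:(lra).
move: ma mb; rewrite !sS.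
have pA := walk_ret_gt0 s a s01; have pB := walk_ret_gt0 s b s01.
have pK := walk_ret_gt0 s (a + b) s01.
have n8 := pair_near_le8 s a b s01; have n0 := pair_near_ge0 s a b s01.
have sh := walk_gap_sharp s (a + b) s01.
have [d0 _] := walk_gap_linear s (a + b) s01.
rewrite walk_nearE.
move: pA pB pK n8 n0 sh d0; rewrite -/N.
set A := walk_ret s a; set B := walk_ret s b; set K := walk_ret s (a + b).
set d := walk_gap s (a + b); set num := pair_near s a b.
move=> pA pB pK n8 n0 sh d0.
have xa : 2 * a%:R / N = 1 + x by rewrite /x Nab; field; rewrite -natrD gt_eqF.
have xb : 2 * b%:R / N = 1 - x by rewrite /x Nab; field; rewrite -natrD gt_eqF.
rewrite xa xb; have -> : 2 * N / N = 2 by field; rewrite -natrD gt_eqF.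
rewrite ![_ * (s * N * _)]mulrCA !(ler_pM2l sN0).
have x1 : - (1/2) <= x by rewrite -(lerD2l 1) -xa ler_pdivlMr //; lra.
have x2 : x <= 1/2.
  suff : 1/2 <= 1 - x by lra.
  by rewrite -xb ler_pdivlMr //; lra.
have sdl : 0 <= s * dl <= dl / 4.
  by rewrite [dl / 4]mulrC (mulr_ge0 (ltW s0) (ltW dl0)) (ler_wpM2r (ltW dl0) s4).
have /andP[sdl0 sdl4] := sdl.
set e := (4 - s) * dl; have -> : (s - 4) * dl = - e by rewrite /e; ring.
have [e0 e4] : 0 <= e /\ e <= 4 * dl by rewrite /e mulrBl; split; lra.
move=> ma mb.
have AB : (A * B) ^+ 2 * ((1 + x - e) * (1 - x - e)) <= K ^+ 4 * 4.
  have -> : (A * B) ^+ 2 * ((1 + x - e) * (1 - x - e)) =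
      (A ^+ 2 * (1 + x - e)) * (B ^+ 2 * (1 - x - e)) by ring.
  apply: (@le_trans _ _ (K ^+ 2 * (2 - e) * (K ^+ 2 * (2 - e)))).
    by apply: ler_pM => //; apply: mulr_ge0 (sqr_ge0 _) _; lra.
  have -> : K ^+ 2 * (2 - e) * (K ^+ 2 * (2 - e)) = K ^+ 4 * (2 - e) ^+ 2 by ring.
  by apply: ler_wpM2l; [apply/exprn_ge0/ltW|nra].
have AB' : (A * B) ^+ 2 * (1 - x ^+ 2 - 8 * dl) <= K ^+ 4 * 4.
  by apply: le_trans AB; apply: ler_wpM2l; [exact: sqr_ge0|nra].
(* Since sN >= 32, the sharp gap bound makes the correction from 4K to [walk_near] of relative order
   dl. *)
have dK : d <= K * dl.
  have g : 0 < 4 * s * N + 6 * s - 8 by lra.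
  rewrite -(ler_pM2r g); apply: le_trans sh _.
  have h1 : 1 <= dl * (4 * s * N + 6 * s - 8) by lra.
  by rewrite -(mulrA K) ler_peMr // ltW.
have Hd : K * (4 * (1 - dl / 2)) <= 4 * K - 2 * d by lra.
have f0 : 0 <= 1 - x ^+ 2 - 8 * dl by nra.
apply: (@le_trans _ _ ((K * (4 * (1 - dl / 2))) ^+ 4)).
  rewrite mulrA.
  have -> : (K * (4 * (1 - dl / 2))) ^+ 4 = K ^+ 4 * 256 * (1 - dl / 2) ^+ 4 by ring.
  rewrite ler_wpM2r ?exprn_ge0 //; first lra.
  apply: (@le_trans _ _ ((8 * (A * B)) ^+ 2 * (1 - x ^+ 2 - 8 * dl))).
    have AB0 : 0 <= 8 * (A * B) by rewrite !mulr_ge0 ?(ltW pA) ?(ltW pB).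
    by rewrite ler_wpM2r // lerXn2r ?nnegrE.
  have -> : (8 * (A * B)) ^+ 2 = 64 * (A * B) ^+ 2 by ring.
  lra.
have K0 : 0 <= K * (4 * (1 - dl / 2)) by apply: mulr_ge0 (ltW pK) _; lra.
by rewrite lerXn2r ?nnegrE // (le_trans K0 Hd).
Qed.

(** The left side is at most 8, while [walk_ret_lower] keeps (L+3)^2 times [walk_near] above 12. *)
Lemma pair_near_poly s a b : 0 <= s <= 4^-1 ->
  pair_near s a b <= ((a + b)%:R + 3) ^+ 4 * walk_near s (a + b) ^+ 2.
Proof.
move=> s01; set L := (a + b)%:R : R.
have L0 : 0 <= L by rewrite /L.
have n8 : pair_near s a b <= 8.
  apply: le_trans (pair_near_le8 s a b s01) _; rewrite ler_piMr //.
  by rewrite mulr_ile1 ?walk_ret_le1 // ltW // walk_ret_gt0.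
apply: le_trans n8 _.
have h1 := walk_ret_lower s (a + b) s01; have h2 := walk_near_ge s (a + b) s01.
rewrite -/L in h1; set H := walk_near s (a + b) in h2 *; set K := walk_ret _ _ in h1 h2.
have q : 12 <= (L + 3) ^+ 2 * H.
  apply: (@le_trans _ _ ((L + 2) * (L + 3) * H)).
    rewrite ler_pdivrMr in h1; last by rewrite mulr_gt0; lra.
    have p : 0 <= (L + 2) * (L + 3) by rewrite mulr_ge0; lra.
    have := ler_wpM2l p h2; lra.
  have K0 := walk_ret_gt0 s (a + b) s01.
  rewrite ler_wpM2r //; last by rewrite expr2 ler_wpM2r; lra.
  by rewrite /H; apply: le_trans h2; rewrite mulr_ge0 // ltW.
have -> : (L + 3) ^+ 4 * H ^+ 2 = ((L + 3) ^+ 2 * H) ^+ 2 by ring.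
nra.
Qed.

End LazyWalk.

(** * Summing over functions on an ordinal one coordinate at a time *)

Section FunctionsOnOrdinals.
Context {T : finType}.

Definition fcons n (t : T) (w : {ffun 'I_n -> T}) : {ffun 'I_n.+1 -> T} :=
  [ffun j => oapp w t (unlift ord0 j)].

Lemma fcons0 n t (w : {ffun 'I_n -> T}) : fcons n t w ord0 = t.
Proof. by rewrite ffunE unlift_none. Qed.

Lemma fcons_lift n t (w : {ffun 'I_n -> T}) j : fcons n t w (lift ord0 j) = w j.
Proof. by rewrite ffunE liftK. Qed.

Lemma sum_ffunS (V : nmodType) n (F : {ffun 'I_n.+1 -> T} -> V) :
  \sum_w F w = \sum_t \sum_(w : {ffun 'I_n -> T}) F (fcons n t w).
Proof.
rewrite pair_big /=.
rewrite (reindex (fun q : T * {ffun 'I_n -> T} => fcons n q.1 q.2)) //=.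
exists (fun w => (w ord0, [ffun j => w (lift ord0 j)])) => [[t w] _ | w _] /=.
  rewrite fcons0; congr pair; apply/ffunP => j; by rewrite ffunE fcons_lift.
apply/ffunP => j; rewrite ffunE; case: unliftP => [i ->|->] //=.
by rewrite ffunE.
Qed.

Lemma sum_ffun0 (V : nmodType) (w0 : {ffun 'I_0 -> T}) (F : {ffun 'I_0 -> T} -> V) :
  \sum_w F w = F w0.
Proof.
by rewrite (big_pred1 w0) // => w /=; apply/esym/eqP/ffunP => -[].
Qed.
End FunctionsOnOrdinals.

(** * The factorisation identity for the weight *)

Section NearWeight.
Context {R : realFieldType}.

Lemma near_wt_eq0 (t : int) : (near_wt t == 0 :> R) = (2 <= `|t|).
Proof.
have [t0|t0] := eqVneq t 0.
  by subst t; rewrite /near_wt /zero_ind /= mulr1 ?add0r ?addr0 pnatr_eq0.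
have [t1|t1] := eqVneq t 1.
  by subst t; rewrite /near_wt /zero_ind /= mulr0 !addr0 oner_eq0.
have [t2|t2] := eqVneq t (-1).
  by subst t; rewrite /near_wt /zero_ind /= mulr0 !add0r oner_eq0.
rewrite /near_wt /zero_ind (negPf t0).
have -> : (t - 1 == 0) = false by lia.
have -> : (t + 1 == 0) = false by lia.
by rewrite mulr0 !addr0 eqxx; lia.
Qed.

(** The larger of |u+v| and |u-v| is |u|+|v|, so both sides vanish when |u| or |v| is at least 2;
    nine cases remain. At the origin it reads 4 = 2 + 2. *)
Lemma near_wt_mul (u v : int) :
  near_wt (u + v) * near_wt (u - v) = near_wt u * zero_ind v + zero_ind u * near_wt v :> R.
Proof.
have [big|] := boolP ((2 <= `|u|) || (2 <= `|v|)).
  have -> : near_wt (u + v) * near_wt (u - v) = 0 :> R.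
    by apply/eqP; rewrite mulf_eq0 !near_wt_eq0; lia.
  case/orP: big => h.
    have /eqP -> : near_wt u == 0 :> R by rewrite near_wt_eq0.
    rewrite /zero_ind (_ : (u == 0) = false); last by lia.
    by rewrite !mul0r addr0.
  have /eqP -> : near_wt v == 0 :> R by rewrite near_wt_eq0.
  rewrite /zero_ind (_ : (v == 0) = false); last by lia.
  by rewrite !mulr0 addr0.
rewrite negb_or -!ltNge => /andP[hu hv].
have : (u == -1) || (u == 0) || (u == 1) by lia.
have : (v == -1) || (v == 0) || (v == 1) by lia.
by case/orP=> [/orP[]|] /eqP -> /orP[/orP[]|] /eqP ->; rewrite /near_wt /zero_ind /=; ring.
Qed.
End NearWeight.

(** * First and second moments of the weighted count *)

Section PairedRows.
Context {R : realFieldType}.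
Variable p : R.

Definition bern (b : bool) : R := if b then p else 1 - p.
Definition pair_wt (t : bool * bool) : R := bern t.1 * bern t.2.
Definition pair_step (t : bool * bool) : int := t.1%:Z - t.2%:Z.
Definition row_wt n (r : {ffun 'I_n -> bool * bool}) : R := \prod_j pair_wt (r j).
Definition row_dot n (x : {ffun 'I_n -> bool}) (r : {ffun 'I_n -> bool * bool}) : int :=
  \sum_j (-1) ^+ x j * pair_step (r j).

Let s := p * (1 - p).

Lemma sum_pair_step (b : bool) (f : int -> R) u :
  \sum_t pair_wt t * f (u + (-1) ^+ b * pair_step t) = lazy_step s f u.
Proof.
rewrite -(pair_big xpredT xpredT
  (fun a b' => pair_wt (a, b') * f (u + (-1) ^+ b * pair_step (a, b')))) /=.
rewrite !big_bool /= /pair_wt /pair_step /bern /=.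
rewrite /lazy_step /s !subrr !subr0 !sub0r mulr0 addr0.
by case: b; rewrite /= ?expr0 ?expr1 ?mulN1r ?mul1r ?opprK; ring.
Qed.

(** Columns where x and y agree drive one walk, the others drive a second one, and the two are
    independent. The signs do not matter because the step law is symmetric. The starting points u, v
    are general so that columns can be peeled off by induction. *)
Lemma sum_row_wt_walk n (x y : {ffun 'I_n -> bool}) (f g : int -> R) u v :
  \sum_r row_wt n r *
     (f (u + \sum_j (if x j == y j then (-1) ^+ x j * pair_step (r j) else 0)) *
      g (v + \sum_j (if x j == y j then 0 else (-1) ^+ x j * pair_step (r j)))) =
  walk_at s (\sum_j (x j == y j)) f u * walk_at s (\sum_j (x j != y j)) g v.
Proof.
elim: n x y u v => [|n IH] x y u v.
  rewrite (sum_ffun0 _ [ffun=> (false, false)]).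
  by rewrite /row_wt !big_ord0 !addr0 mul1r.
pose x' := [ffun j => x (lift ord0 j)]; pose y' := [ffun j => y (lift ord0 j)].
have ex j : x (lift ord0 j) = x' j by rewrite ffunE.
have ey j : y (lift ord0 j) = y' j by rewrite ffunE.
rewrite sum_ffunS.
rewrite !big_ord_recl.
rewrite (eq_bigr (fun j => (x' j == y' j) : nat)); last by move=> j _; rewrite ex ey.
rewrite [X in walk_at s (_ + X) g](eq_bigr (fun j => (x' j != y' j) : nat)); last first.
  by move=> j _; rewrite ex ey.
transitivity (\sum_t pair_wt t *
   (walk_at s (\sum_j (x' j == y' j)) f
      (u + if x ord0 == y ord0 then (-1) ^+ x ord0 * pair_step t else 0) *
    walk_at s (\sum_j (x' j != y' j)) g
      (v + if x ord0 == y ord0 then 0 else (-1) ^+ x ord0 * pair_step t))).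
  apply: eq_bigr => t _; rewrite -IH big_distrr /=; apply: eq_bigr => r _.
  rewrite /row_wt big_ord_recl fcons0 -mulrA; congr (_ * _).
  congr (_ * _); first by apply: eq_bigr => j _; rewrite fcons_lift.
  rewrite !big_ord_recl fcons0 !addrA.
  congr (f (_ + _) * g (_ + _)); apply: eq_bigr => j _; by rewrite fcons_lift ex ey.
case: eqP => e /=.
  under eq_bigr do rewrite addr0 mulrA.
  by rewrite -big_distrl /= sum_pair_step.
under eq_bigr do rewrite addr0 [_ * walk_at s _ g _]mulrC mulrA.
by rewrite -big_distrl /= sum_pair_step mulrC.
Qed.

Lemma row_dot_split n (x y : {ffun 'I_n -> bool}) (r : {ffun 'I_n -> bool * bool}) :
  let u := \sum_j (if x j == y j then (-1) ^+ x j * pair_step (r j) else 0) in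
  let v := \sum_j (if x j == y j then 0 else (-1) ^+ x j * pair_step (r j)) in
  row_dot n x r = u + v /\ row_dot n y r = u - v.
Proof.
rewrite /= -sumrN -!big_split /=; split; apply: eq_bigr => j _.
  by case: ifP => _; rewrite ?addr0 ?add0r.
case: eqVneq => [->|]; first by rewrite oppr0 addr0.
by case: (x j) (y j) => [] [] //= _; rewrite ?expr1 ?expr0 ?mulN1r ?mul1r ?add0r ?opprK.
Qed.

Lemma sum_row_near n (x y : {ffun 'I_n -> bool}) :
  \sum_r row_wt n r * (near_wt (row_dot n x r) * near_wt (row_dot n y r)) =
  pair_near s (\sum_j (x j == y j)) (\sum_j (x j != y j)).
Proof.
rewrite /pair_near /walk_near /walk_ret /walk_prob.
rewrite -!(sum_row_wt_walk n x y) -big_split /=; apply: eq_bigr => r _.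
have [-> ->] := row_dot_split n x y r.
by rewrite near_wt_mul !add0r mulrDr.
Qed.

Lemma sum_row_near1 n (x : {ffun 'I_n -> bool}) :
  \sum_r row_wt n r * near_wt (row_dot n x r) = walk_near s n.
Proof.
have := sum_row_wt_walk n x x near_wt (fun=> 1) 0 0.
under eq_bigr do rewrite eqxx.
under [X in walk_at s X (fun=> 1)]eq_bigr do rewrite eqxx.
rewrite sum1_card card_ord [X in walk_at s X (fun=> 1)]big1 // [walk_at s 0 _ _]/= mulr1.
rewrite /walk_near => <-.
apply: eq_bigr => r _; rewrite mulr1 add0r; congr (_ * near_wt _).
by apply: eq_bigr => j _; rewrite eqxx.
Qed.

Lemma sum_row_wt n : \sum_r row_wt n r = 1.
Proof.
have b1 : \sum_b bern b = 1 by rewrite big_bool /= addrC subrK.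
have t1 : \sum_t pair_wt t = 1.
  rewrite -(pair_big xpredT xpredT (fun a b => bern a * bern b)) /=.
  by under eq_bigr do rewrite -big_distrr /= b1 mulr1.
rewrite /row_wt -(bigA_distr_bigA (fun (_ : 'I_n) t => pair_wt t)) /=.
by rewrite big1.
Qed.

Variable m n : nat.
Implicit Types (w : {ffun 'I_m -> {ffun 'I_n -> bool * bool}}) (x y z : {ffun 'I_n -> bool}).

Definition mat_wt w : R := \prod_i row_wt n (w i).
Definition near_count w : R := \sum_x \prod_i near_wt (row_dot n x (w i)).

Lemma sum_mat_wt_prod (g : {ffun 'I_n -> bool * bool} -> R) :
  \sum_w mat_wt w * \prod_i g (w i) = (\sum_r row_wt n r * g r) ^+ m.
Proof.
rewrite /mat_wt; under eq_bigr do rewrite -big_split /=.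
rewrite -(bigA_distr_bigA (fun (_ : 'I_m) r => row_wt n r * g r)) /=.
by rewrite prodr_const card_ord.
Qed.

Lemma sum_mat_wt : \sum_w mat_wt w = 1.
Proof.
transitivity (\sum_w mat_wt w * \prod_(i < m) (fun=> 1) (w i)).
  by apply: eq_bigr => w _; rewrite big1 ?mulr1.
rewrite (sum_mat_wt_prod (fun=> 1)).
by under eq_bigr do rewrite mulr1; rewrite sum_row_wt expr1n.
Qed.

Lemma mean_near_count :
  \sum_w mat_wt w * near_count w = 2 ^+ n * walk_near s n ^+ m.
Proof.
under eq_bigr do rewrite big_distrr /=.
rewrite exchange_big /=.
under eq_bigr => x _ do
  rewrite (sum_mat_wt_prod (fun r => near_wt (row_dot n x r))) sum_row_near1.
by rewrite sumr_const card_ffun card_bool card_ord -[LHS]mulr_natl natrX.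
Qed.

Definition agree z : nat := \sum_j z j.
Definition disagree z : nat := \sum_j ~~ z j.

Lemma agreeD z : (agree z + disagree z)%N = n.
Proof.
rewrite /agree /disagree -big_split /=.
rewrite (eq_bigr (fun=> 1%N)) ?sum1_card ?card_ord // => j _.
by case: (z j).
Qed.

Lemma second_moment_near_count :
  \sum_w mat_wt w * near_count w ^+ 2 =
  2 ^+ n * \sum_z pair_near s (agree z) (disagree z) ^+ m.
Proof.
transitivity (\sum_x \sum_y (\sum_w mat_wt w *
    \prod_i (near_wt (row_dot n x (w i)) * near_wt (row_dot n y (w i))))).
  under [RHS]eq_bigr do rewrite exchange_big.
  rewrite [RHS]exchange_big /=; apply: eq_bigr => w _.
  under [RHS]eq_bigr do rewrite -big_distrr /=.
  rewrite -big_distrr /=; congr (_ * _).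
  rewrite expr2 /near_count big_distrl /=; apply: eq_bigr => x _.
  by rewrite big_distrr /=; apply: eq_bigr => y _; rewrite big_split.
under eq_bigr => x _.
  under eq_bigr => y _ do
    rewrite (sum_mat_wt_prod (fun r => near_wt (row_dot n x r) * near_wt (row_dot n y r)))
      sum_row_near.
  (* Replace y by its agreement pattern z with x: the summand then no longer depends on x, and the
     sum over x gives 2^n. *)
  rewrite (reindex (fun z : {ffun 'I_n -> bool} => [ffun j => x j == z j])) /=; last first.
    have inv : involutive (fun z : {ffun 'I_n -> bool} => [ffun j => x j == z j]).
      by move=> z; apply/ffunP => j; rewrite !ffunE; case: (x j) (z j) => [] [].
    by apply: onW_bij; apply: inv_bij.
  under eq_bigr => z _.
    rewrite (_ : (\sum_j (x j == [ffun j => x j == z j] j))%N = agree z); last first.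
      by apply: eq_bigr => j _; rewrite ffunE; case: (x j) (z j) => [] [].
    rewrite (_ : (\sum_j (x j != [ffun j => x j == z j] j))%N = disagree z); last first.
      by apply: eq_bigr => j _; rewrite ffunE; case: (x j) (z j) => [] [].
    over.
  over.
by rewrite sumr_const card_ffun card_bool card_ord -[LHS]mulr_natl natrX.
Qed.

Hypothesis p01 : 0 < p <= 2^-1.

Lemma mat_wt_ge0 w : 0 <= mat_wt w.
Proof.
case/andP: p01 => p0 p2.
apply: prodr_ge0 => i _; apply: prodr_ge0 => j _.
by rewrite /pair_wt /bern; case: ifP; case: ifP => _ _; rewrite mulr_ge0 //; lra.
Qed.

Lemma variance_bounds : 0 < s <= 4^-1 /\ p / 2 <= s.
Proof.
case/andP: p01 => p0 p2; rewrite /s; split; last by nra.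
by rewrite mulr_gt0 //=; nra.
Qed.

(** Chebyshev: on the event that the count is 0, its squared deviation equals the squared mean. *)
Lemma near_count_eq0_mass :
  \sum_(w | near_count w == 0) mat_wt w <=
  (2 ^+ n)^-1 * (\sum_z (pair_near s (agree z) (disagree z) / walk_near s n ^+ 2) ^+ m) - 1.
Proof.
set E := \sum_w mat_wt w * near_count w.
have E2 : \sum_w mat_wt w * (near_count w - E) ^+ 2 =
    \sum_w mat_wt w * near_count w ^+ 2 - E ^+ 2.
  have expand e : \sum_w mat_wt w * (near_count w - e) ^+ 2 =
    \sum_w mat_wt w * near_count w ^+ 2 - 2 * e * (\sum_w mat_wt w * near_count w)
      + e ^+ 2 * \sum_w mat_wt w.
    by rewrite !big_distrr /= -sumrN -!big_split /=; apply: eq_bigr => w _; ring.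
  by rewrite expand sum_mat_wt -/E; ring.
have Hn : 0 < walk_near s n.
  have [/andP[s0 s4] _] := variance_bounds; have s01 : 0 <= s <= 4^-1 by rewrite ltW.
  by apply: lt_le_trans (walk_near_ge s n s01); rewrite mulr_gt0 ?walk_ret_gt0.
have E0 : 0 < E by rewrite /E mean_near_count mulr_gt0 ?exprn_gt0.
have E20 : 0 < E ^+ 2 by rewrite exprn_gt0.
rewrite -(ler_pM2r E20).
apply: (@le_trans _ _ (\sum_w mat_wt w * (near_count w - E) ^+ 2)).
  rewrite big_distrl /= big_mkcond /=; apply: ler_sum => w _.
  case: eqP => [->|_]; first by rewrite sub0r sqrrN.
  by rewrite mulr_ge0 ?sqr_ge0 ?mat_wt_ge0.
rewrite E2 mulrBl mul1r lerD2r second_moment_near_count /E mean_near_count.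
under [X in _ <= _ * X * _]eq_bigr do rewrite expr_div_n.
rewrite -big_distrl /= [(walk_near s n ^+ 2) ^+ m]exprAC.
have H0 : walk_near s n ^+ m != 0.
  by rewrite expf_neq0 // gt_eqF.
have n0 : 2 ^+ n != 0 :> R by rewrite expf_neq0 // pnatr_eq0.
by rewrite le_eqVlt; apply/orP; left; apply/eqP; field; rewrite H0 n0.
Qed.
End PairedRows.

(** * Gaussian moments of a sum of random signs *)

Section GaussianMoment.
Context {R : realType}.

Lemma expRN2_le (y : R) : 0 <= y <= 2^-1 -> expR (- (2 * y)) <= 1 - y.
Proof.
move=> /andP[y0 y2]; rewrite expRN -div1r ler_pdivrMr ?expR_gt0 //.
have h := expR_ge1Dx (2 * y).
have : (1 - y) * (1 + 2 * y) <= (1 - y) * expR (2 * y) by rewrite ler_wpM2l //; lra.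
nra.
Qed.

Lemma cosh_le_gauss (t : R) : expR t + expR (- t) <= 2 * expR (2 * t ^+ 2).
Proof.
wlog t0 : t / 0 <= t.
  move=> h; have [/h//|/ltW t0] := leP 0 t.
  by have := h (- t); rewrite opprK sqrrN addrC; apply; rewrite oppr_ge0.
(* For t >= 1/2 the exponent t is at most 2t^2; below that, the inequality e^y >= 1 + y is enough
   thanks to the generous constant 2. *)
have [th|th] := leP (2^-1) t.
  have e1 : expR t <= expR (2 * t ^+ 2) by rewrite ler_expR; nra.
  have e2 : expR (- t) <= expR (2 * t ^+ 2) by rewrite ler_expR; nra.
  lra.
have t2 : 0 <= t ^+ 2 <= 2^-1 by rewrite sqr_ge0 /=; nra.
have := expRN2_le _ t2.
have h1 : (1 - t) * expR t <= 1.
  by have := expR_ge1Dx (- t); rewrite expRN -div1r ler_pdivlMr ?expR_gt0 //.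
have h2 : (1 + t) * expR (- t) <= 1.
  by rewrite expRN ler_pdivrMr ?expR_gt0 // mul1r expR_ge1Dx.
rewrite expRN -div1r ler_pdivrMr ?expR_gt0 // => h3.
have p1 : 0 < 1 - t ^+ 2 by nra.
have h4 : (expR t + expR (- t)) * (1 - t ^+ 2) <= 2.
  have : (1 + t) * ((1 - t) * expR t) <= (1 + t) * 1 by rewrite ler_wpM2l //; lra.
  have : (1 - t) * ((1 + t) * expR (- t)) <= (1 - t) * 1 by rewrite ler_wpM2l //; lra.
  nra.
rewrite -(ler_pM2r p1); apply: le_trans h4 _; lra.
Qed.

Definition imbalance n (z : {ffun 'I_n -> bool}) : R := (agree n z)%:R - (disagree n z)%:R.

Definition gauss_moment n (mu : R) : R :=
  (2 ^+ n)^-1 * \sum_(z : {ffun 'I_n -> bool}) expR (mu * imbalance n z ^+ 2).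

Lemma imbalance_fcons n b (z : {ffun 'I_n -> bool}) :
  imbalance n.+1 (fcons n b z) = imbalance n z + (if b then 1 else -1).
Proof.
have ea : agree n.+1 (fcons n b z) = (b + agree n z)%N.
  by rewrite /agree big_ord_recl fcons0; congr addn; apply: eq_bigr => j _; rewrite fcons_lift.
have ed : disagree n.+1 (fcons n b z) = (~~ b + disagree n z)%N.
  by rewrite /disagree big_ord_recl fcons0; congr addn; apply: eq_bigr => j _; rewrite fcons_lift.
by rewrite /imbalance ea ed; case: b {ea ed}; rewrite !natrD /=; ring.
Qed.

(** Averaging over one sign turns mu(S+-1)^2 into mu S^2 + mu and a factor cosh(2 mu S), which
    [cosh_le_gauss] absorbs into the quadratic term. *)
Lemma gauss_momentS n mu : 0 <= mu ->
  gauss_moment n.+1 mu <= expR mu * gauss_moment n (mu + 8 * mu ^+ 2).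
Proof.
move=> mu0; rewrite /gauss_moment sum_ffunS big_bool /= -big_split /=.
rewrite [leRHS]mulrCA exprS invfM [2^-1 * _]mulrC -mulrA.
apply: ler_wpM2l; first by rewrite invr_ge0 exprn_ge0.
rewrite ler_pdivrMl // !big_distrr /=; apply: ler_sum => z _.
rewrite !imbalance_fcons; set S := imbalance n z.
have -> : mu * (S + 1) ^+ 2 = (mu * S ^+ 2 + mu) + 2 * mu * S by ring.
have -> : mu * (S - 1) ^+ 2 = (mu * S ^+ 2 + mu) + - (2 * mu * S) by ring.
rewrite expRD [X in _ + X]expRD -mulrDr.
have := cosh_le_gauss (2 * mu * S).
have -> : (mu + 8 * mu ^+ 2) * S ^+ 2 = mu * S ^+ 2 + 2 * (2 * mu * S) ^+ 2 by ring.
rewrite !expRD.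
have := expR_ge0 (mu * S ^+ 2 + mu); rewrite expRD => e0 /(ler_wpM2l e0).
lra.
Qed.

                                                        
(** Under mu -> mu + 8 mu^2 the inverse 1/mu drops by at most 8. For positive mu and nu the
    hypothesis says 1/mu >= 1/nu + 8n, so mu stays below nu for n steps and each step costs a factor
    of at most exp(nu). *)
Lemma gauss_moment_bound n (mu nu : R) : 0 <= mu -> 0 <= nu ->
  mu * (1 + 8 * n%:R * nu) <= nu -> gauss_moment n mu <= expR (n%:R * nu).
Proof.
elim: n mu => [|n IH] mu mu0 nu0 h.
  rewrite /gauss_moment (sum_ffun0 _ [ffun=> false]) /imbalance /agree /disagree !big_ord0.
  by rewrite subrr expr0n mulr0 mul0r expR0 invr1 mulr1.
apply: le_trans (gauss_momentS n mu mu0) _.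
have L0 : 0 <= n%:R :> R by [].
move: h; rewrite -(natr1 n) => h.
have nL : 0 <= n%:R * nu :> R by rewrite mulr_ge0.
have mnL : 0 <= mu * (n%:R * nu) :> R by rewrite mulr_ge0.
have mn : 0 <= mu * nu by rewrite mulr_ge0.
have -> : (n%:R + 1) * nu = nu + n%:R * nu by ring.
rewrite [leRHS]expRD.
apply: ler_pM; rewrite ?expR_ge0 //.
- by rewrite mulr_ge0 ?invr_ge0 ?exprn_ge0 // sumr_ge0 // => z _; rewrite expR_ge0.
- by rewrite ler_expR; lra.
apply: IH => //; first by rewrite addr_ge0 ?mulr_ge0 ?sqr_ge0.
have : mu * (1 + 8 * n%:R * nu) <= nu - 8 * (mu * nu) by lra.
have p8 : 0 <= 1 + 8 * mu by lra.
move=> /(ler_wpM2l p8).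
have : 0 <= mu * (mu * nu) by rewrite mulr_ge0.
lra.
Qed.

End GaussianMoment.

(** * Bounding the failure probabilities *)

Section SecondMomentBound.
Context {R : realType}.
Variable p : R.
Hypothesis p01 : 0 < p <= 2^-1.
Let s := p * (1 - p).
Variable n : nat.
Hypothesis sn : 32 <= s * n%:R.
Implicit Types z : {ffun 'I_n -> bool}.

Let ratio z := pair_near s (agree n z) (disagree n z) / walk_near s n ^+ 2.

Let s0 : 0 < s. Proof. by have [/andP[]] := variance_bounds p p01. Qed.
Let s4 : s <= 4^-1. Proof. by have [/andP[]] := variance_bounds p p01. Qed.
Let s01 : 0 <= s <= 4^-1. Proof. by rewrite ltW ?s0 ?s4. Qed.
Let n0 : 0 < n%:R :> R. Proof. by rewrite -(pmulr_rgt0 _ s0); apply: lt_le_trans sn. Qed.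
Let Hn : 0 < walk_near s n.
Proof. by apply: lt_le_trans (walk_near_ge s n s01); rewrite mulr_gt0 ?walk_ret_gt0. Qed.

Lemma near_ratio_ge0 z : 0 <= ratio z.
Proof. by rewrite divr_ge0 ?pair_near_ge0 ?exprn_ge0 // ltW. Qed.

Lemma near_ratio_poly z : ratio z <= (n%:R + 3) ^+ 4.
Proof.
rewrite ler_pdivrMr ?exprn_gt0 //.
by have := pair_near_poly s (agree n z) (disagree n z) s01; rewrite agreeD.
Qed.

(** [pair_near_sqr] followed by 1 - y >= exp(-2y) on each factor; the squared ratio collects the
    exponent 2(x^2 + 8 dl) + 4 dl. *)
Lemma near_ratio_central z : imbalance n z ^+ 2 <= (n%:R / 2) ^+ 2 :> R ->
  ratio z <= expR ((imbalance n z / n%:R) ^+ 2 + 10 / (s * n%:R)).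
Proof.
move=> cen.
have e : (agree n z)%:R + (disagree n z)%:R = n%:R :> R by rewrite -natrD agreeD.
have n2 : 0 <= n%:R / 2 :> R by rewrite divr_ge0.
have [c1 c2] : - (n%:R / 2) <= imbalance n z :> R /\ imbalance n z <= n%:R / 2 :> R.
  by apply/andP; rewrite -ler_norml -(ler_sqr (normr_ge0 _)) ?nnegrE // real_normK ?num_real.
rewrite /imbalance in c1 c2.
have := @pair_near_sqr _ s (agree n z) (disagree n z); rewrite agreeD /= s0 s4 => /(_ isT).
move=> /(_ ltac:(lra) ltac:(lra) sn).
rewrite -/(imbalance n z).
set x := imbalance n z / n%:R; set dl := (s * n%:R)^-1 => key.
have x2 : x ^+ 2 <= 4^-1.
  rewrite expr_div_n ler_pdivrMr ?exprn_gt0 //; apply: le_trans cen _; lra.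
have sn0 : 0 < s * n%:R by apply: lt_le_trans sn.
have dl0 : 0 < dl by rewrite invr_gt0.
have dl32 : dl <= 32^-1 by rewrite lef_pV2 ?posrE.
have x0 := sqr_ge0 x.
have b1 := @expRN2_le _ (x ^+ 2 + 8 * dl); have b2 := @expRN2_le _ (dl / 2).
have {}b1 := b1 ltac:(lra); have {}b2 := b2 ltac:(lra).
have E : expR (- (2 * (x ^+ 2 + 10 * dl))) <= (1 - x ^+ 2 - 8 * dl) * (1 - dl / 2) ^+ 4.
  have -> : - (2 * (x ^+ 2 + 10 * dl)) =
      - (2 * (x ^+ 2 + 8 * dl)) + 4%:R * (- (2 * (dl / 2))) by field.
  rewrite expRD expRM_natl ler_pM ?expR_ge0 ?exprn_ge0 ?expR_ge0 //; first by lra.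
  by rewrite lerXn2r ?nnegrE ?expR_ge0 //; lra.
have r1 : ratio z ^+ 2 * expR (- (2 * (x ^+ 2 + 10 * dl))) <= 1.
  apply: le_trans (ler_wpM2l (sqr_ge0 _) E) _.
  rewrite /ratio expr_div_n mulrAC ler_pdivrMr ?mul1r ?exprn_gt0 ?exprn_gt0 //.
  by rewrite -exprM.
have : ratio z ^+ 2 <= expR (x ^+ 2 + 10 * dl) ^+ 2.
  by move: r1; rewrite expRN ler_pdivrMr ?expR_gt0 // mul1r -expRM_natl.
by rewrite ler_sqr // nnegrE ?near_ratio_ge0 ?expR_ge0.
Qed.

Variable m : nat.
Hypothesis mn : 16 * m%:R <= n%:R :> R.

                                                                                                
Lemma near_count_eq0_mass_bound :
  \sum_(w | near_count m n w == 0 :> R) mat_wt p m n w <=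
  expR (11 * (m%:R / (s * n%:R))) - 1 + (n%:R + 3) ^+ (4 * m) * expR (16^-1 - n%:R / 128).
Proof.
apply: le_trans (near_count_eq0_mass p m n p01) _.
rewrite addrAC lerD2r -/s.
(* [mu1] turns the m-th power of the central bound into a Gaussian moment. [mu2] serves an
   exponential Markov bound: on far patterns mu2 S^2 exceeds n/128. Both satisfy n mu <= 1/16, which
   is what [gauss_moment_bound] needs with nu = 2 mu. *)
pose mu1 : R := m%:R / n%:R ^+ 2; pose mu2 : R := (32 * n%:R)^-1.
apply: (@le_trans _ _ (expR (m%:R * (10 / (s * n%:R))) * gauss_moment n mu1
   + (n%:R + 3) ^+ (4 * m) * expR (- (n%:R / 128)) * gauss_moment n mu2)).
  rewrite /gauss_moment [X in X + _]mulrCA [X in _ + X]mulrCA -mulrDr.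
  rewrite ler_wpM2l ?invr_ge0 ?exprn_ge0 // !big_distrr -big_split /=.
  apply: ler_sum => z _; rewrite -/(ratio z).
  have q0 : 0 <= n%:R + 3 :> R by rewrite addr_ge0.
  have [cen|far] := leP (imbalance n z ^+ 2) ((n%:R / 2) ^+ 2 : R).
    rewrite -[leLHS]addr0; apply: lerD; last by rewrite mulr_ge0 ?mulr_ge0 ?exprn_ge0 ?expR_ge0.
    have := near_ratio_central z cen => rc.
    apply: (@le_trans _ _ (expR ((imbalance n z / n%:R) ^+ 2 + 10 / (s * n%:R)) ^+ m)).
      by rewrite lerXn2r ?nnegrE ?near_ratio_ge0 ?expR_ge0.
    rewrite -expRM_natl -expRD ler_expR le_eqVlt; apply/orP; left; apply/eqP.
    by rewrite /mu1; field; rewrite !gt_eqF.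
  rewrite -[leLHS]add0r; apply: lerD; first by rewrite mulr_ge0 ?expR_ge0.
  rewrite -mulrA -expRD exprM.
  apply: (@le_trans _ _ (((n%:R + 3) ^+ 4) ^+ m)).
    by rewrite lerXn2r ?nnegrE ?near_ratio_ge0 ?near_ratio_poly ?exprn_ge0.
  rewrite ler_peMr ?exprn_ge0 //.
  rewrite -[leLHS]expR0 ler_expR.
  have m2 : 0 <= mu2 by rewrite invr_ge0 mulr_ge0.
  have := ler_wpM2l m2 (ltW far).
  have -> : mu2 * (n%:R / 2) ^+ 2 = n%:R / 128 by rewrite /mu2; field; rewrite gt_eqF.
  lra.
have g1 : gauss_moment n mu1 <= expR (n%:R * (2 * mu1)).
  have m1 : 0 <= mu1 by rewrite divr_ge0 ?exprn_ge0.
  apply: gauss_moment_bound => //; first by rewrite mulr_ge0.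
  have : n%:R * mu1 <= 16^-1.
    rewrite /mu1 mulrA ler_pdivrMr ?exprn_gt0 //.
    have := ler_wpM2l (ltW n0) mn; lra.
  move=> /(ler_wpM2l m1); lra.
have g2 : gauss_moment n mu2 <= expR (n%:R * (2 * mu2)).
  have m2 : 0 <= mu2 by rewrite invr_ge0 mulr_ge0.
  apply: gauss_moment_bound => //; first by rewrite mulr_ge0.
  have : n%:R * mu2 <= 16^-1.
    rewrite /mu2 ler_pdivrMr ?mulr_gt0 //.
    have := ltW n0; lra.
  move=> /(ler_wpM2l m2); lra.
apply: lerD.
  apply: le_trans (ler_wpM2l (expR_ge0 _) g1) _.
  rewrite -expRD ler_expR.
  have -> : m%:R * (10 / (s * n%:R)) + n%:R * (2 * mu1) = (10 + 2 * s) * (m%:R / (s * n%:R)).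
    by rewrite /mu1; field; rewrite !gt_eqF.
  rewrite ler_wpM2r //; last by have := s4; lra.
  by rewrite divr_ge0 // mulr_ge0 // ltW.
rewrite -mulrA; apply: ler_wpM2l; first by rewrite exprn_ge0 ?addr_ge0.
apply: le_trans (ler_wpM2l (expR_ge0 _) g2) _.
rewrite -expRD ler_expR /mu2 le_eqVlt; apply/orP; left; apply/eqP; field.
by rewrite gt_eqF.
Qed.

Definition row_odd (r : {ffun 'I_n -> bool * bool}) : bool :=
  odd (\sum_j ((r j).1 + (r j).2)).

Lemma sum_row_parity :
  \sum_r row_wt p n r * (-1) ^+ (\sum_j ((r j).1 + (r j).2)) = ((1 - 2 * p) ^+ 2) ^+ n.
Proof.
under eq_bigr do rewrite expr_sum -big_split /=.
rewrite -(bigA_distr_bigA (fun (_ : 'I_n) t => pair_wt p t * (-1) ^+ (t.1 + t.2))) /=.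
rewrite prodr_const card_ord; congr (_ ^+ _).
rewrite -(pair_big xpredT xpredT (fun a b => pair_wt p (a, b) * (-1) ^+ (a + b))) /=.
by rewrite !big_bool /pair_wt /bern /=; ring.
Qed.

(** The probability that a row is even is (1 + E(-1)^sum)/2, and the expectation (1-2p)^(2n) is at
    most exp(-2pn), hence below 1/2 because pn >= 32. *)
Lemma even_rows_mass :
  \sum_(w : {ffun 'I_m -> {ffun 'I_n -> bool * bool}} | [forall i, ~~ row_odd (w i)])
      mat_wt p m n w <= (3 / 4) ^+ m.
Proof.
have [p0 p2] := andP p01.
have -> : \sum_(w : {ffun 'I_m -> {ffun 'I_n -> bool * bool}} | [forall i, ~~ row_odd (w i)])
      mat_wt p m n w =
    \sum_(w : {ffun 'I_m -> {ffun 'I_n -> bool * bool}})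
      mat_wt p m n w * \prod_i (~~ row_odd (w i))%:R.
  rewrite big_mkcond /=; apply: eq_bigr => w _.
  case: forallP => [h|/forallP]; first by rewrite big1 ?mulr1 // => i _; rewrite h.
  rewrite negb_forall => /existsP[i hi].
  by rewrite (bigD1 i) //= (negPf hi) mul0r mulr0.
rewrite (sum_mat_wt_prod p m n (fun r => (~~ row_odd r)%:R)).
have -> : \sum_r row_wt p n r * (~~ row_odd r)%:R =
    (\sum_r row_wt p n r + \sum_r row_wt p n r * (-1) ^+ (\sum_j ((r j).1 + (r j).2))) / 2.
  rewrite -big_split /= mulr_suml; apply: eq_bigr => r _.
  by rewrite /row_odd -signr_odd; case: odd; rewrite /= ?expr1 ?expr0; field.
rewrite sum_row_wt sum_row_parity.
have q0 : 0 <= 1 - 2 * p by lra.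
suff : ((1 - 2 * p) ^+ 2) ^+ n <= 1 / 2.
  by move=> h; rewrite lerXn2r ?nnegrE //; have := exprn_ge0 n (sqr_ge0 (1 - 2 * p)); lra.
have e1 : (1 - 2 * p) ^+ 2 <= expR (- (2 * p)).
  have h := expR_ge1Dx (- (2 * p)).
  by apply: le_trans h; nra.
apply: (@le_trans _ _ (expR (- (2 * p)) ^+ n)).
  by rewrite lerXn2r ?nnegrE ?expR_ge0 ?sqr_ge0.
rewrite -expRM_natl mulrN expRN -[leLHS]div1r.
rewrite ler_pdivrMr ?expR_gt0 //.
have := expR_ge1Dx (n%:R * (2 * p)).
have : s * n%:R <= p * n%:R by rewrite ler_wpM2r //; rewrite /s; nra.
have := sn; lra.
Qed.
End SecondMomentBound.

(** * From the weighted count and row parities to the discrepancy *)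

Section Discrepancy.
Context {R : realType}.
Variables m n : nat.

Definition pair_columns (B : 'I_m -> 'I_(n + n) -> bool) :
    {ffun 'I_m -> {ffun 'I_n -> bool * bool}} :=
  [ffun i => [ffun j => (B i (lshift n j), B i (rshift n j))]].

Definition bool_mx (B : 'I_m -> 'I_(n + n) -> bool) : 'M[R]_(m, n + n) :=
  \matrix_(i, j) (B i j)%:R.

Lemma bool_mx_sign_entry B (s : 'cV[bool]_(n + n)) i :
  (bool_mx B *m sign_vec R s) i 0 =
  (\sum_k ((B i k)%:Z - 2 * (B i k && s k 0)%:Z))%:~R.
Proof.
rewrite mxE rmorph_sum; apply: eq_bigr => k _; rewrite !mxE.
by case: (B i k) (s k 0) => [] []; rewrite /= ?expr1 ?expr0 ?mul0r ?mul1r ?subr0.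
Qed.

(** Changing signs alters an integer row sum by an even amount, so an odd row never sums to 0. *)
Lemma norm_ge1_of_odd B i s : row_odd n (pair_columns B i) ->
  1 <= `|bool_mx B *m sign_vec R s|.
Proof.
move=> od; rewrite [leRHS]mx_normrE.
apply: le_trans (le_bigmax _ _ (i, 0)) => /=.
rewrite bool_mx_sign_entry -intr_norm -[1]/(1%:~R) ler_int -gtz0_ge1 normr_gt0.
apply/negP => /eqP z0.
have e : (\sum_k (B i k : nat))%N = (2 * \sum_k (B i k && s k 0%R))%N.
  apply/eqP; rewrite -eqz_nat -subr_eq0 -{}z0 PoszM sumrB -mulr_sumr; apply/eqP.
  by congr (_ - 2 * _); apply: (big_morph Posz PoszD).
move: od; rewrite /row_odd.
rewrite (_ : (\sum_j _)%N = (\sum_k (B i k : nat))%N); first by rewrite e oddM.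
by rewrite big_split_ord /= -big_split /=; apply: eq_bigr => j _; rewrite !ffunE.
Qed.

Definition balanced_sign (x : {ffun 'I_n -> bool}) : 'cV[bool]_(n + n) :=
  \col_k (match fintype.split k with inl j => x j | inr j => ~~ x j end).

Lemma bool_mx_balanced_entry B x i :
  (bool_mx B *m sign_vec R (balanced_sign x)) i 0 = (row_dot n x (pair_columns B i))%:~R.
Proof.
rewrite mxE big_split_ord /row_dot rmorph_sum /= -big_split; apply: eq_bigr => j _ /=.
rewrite !mxE !ffunE /= (unsplitK (inl j)) (unsplitK (inr j)) /pair_step /=.
by case: (x j) (B i (lshift n j)) (B i (rshift n j)) => [] [] []; rewrite /= ?expr1 ?expr0; ring.
Qed.

Lemma norm_le1_of_near B x :
  (forall i, near_wt (row_dot n x (pair_columns B i)) != 0 :> R) ->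
  `|bool_mx B *m sign_vec R (balanced_sign x)| <= 1.
Proof.
move=> near; rewrite [leLHS]mx_normrE; apply: bigmax_le => // -[i j] _ /=.
rewrite ord1 bool_mx_balanced_entry -intr_norm -[1]/(1%:~R) ler_int.
by move: (near i); rewrite near_wt_eq0; lia.
Qed.

Lemma disc_bool_mx_eq1 B : near_count m n (pair_columns B) != 0 :> R ->
  ~~ [forall i, ~~ row_odd n (pair_columns B i)] -> disc (bool_mx B) = 1.
Proof.
move=> near; rewrite negb_forall => /existsP[i]; rewrite negbK => od.
have [x nx] : exists x, forall i, near_wt (row_dot n x (pair_columns B i)) != 0 :> R.
  apply/not_existsP => none; case/negP: near.
  rewrite /near_count big1 // => x _.
  have /existsNP[k /negP] := none x; rewrite negbK => /eqP k0.
  by rewrite (bigD1 k) //= k0 mul0r.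
rewrite /disc; case: arg_minP => //= s _ smin.
apply/le_anti/andP; split; last exact: norm_ge1_of_odd od.
exact: le_trans (smin _ isT) (norm_le1_of_near _ _ nx).
Qed.
End Discrepancy.

(** * Transfer to the law of the random matrix *)

Section BernoulliMatrix.
Context {R : realType} {d : measure_display} {T : measurableType d} {P : probability T R}.
Variables (m n : nat) (p : R) (X : 'I_m -> 'I_(n + n) -> {RV P >-> bool}).
Hypothesis p01 : 0 < p <= 2^-1.
Hypothesis XP : bernoulli_entries p X.

Let code (w : T) := pair_columns m n (fun i k => X i k w).

Lemma measurable_RV_preimage (Y : {RV P >-> bool}) (A : set bool) : measurable (Y @^-1` A).
Proof.
by have := measurable_funP Y measurableT (A : set bool); rewrite setTI; apply.
Qed.

Lemma code_fiberE (q : {ffun 'I_m -> {ffun 'I_n -> bool * bool}}) :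
  code @^-1` [set q] =
  \bigcap_(ij in [set` [set: 'I_m * 'I_(n + n)]%SET])
     (X ij.1 ij.2 @^-1` [set match fintype.split ij.2 with
                             | inl j => (q ij.1 j).1 | inr j => (q ij.1 j).2 end]).
Proof.
apply/seteqP; split => w /=.
  move=> <- [i k] _ /=; rewrite -{1}(splitK k).
  by case: fintype.split => j /=; rewrite !ffunE.
move=> h; apply/ffunP => i; apply/ffunP => j; rewrite !ffunE.
have := h (i, lshift n j); have := h (i, rshift n j); rewrite /= !inE.
move=> /(_ isT) -> /(_ isT) ->.
by rewrite (unsplitK (inl j)) (unsplitK (inr j)) -surjective_pairing.
Qed.

Lemma measurable_code_fiber q : measurable (code @^-1` [set q]).
Proof.
rewrite code_fiberE; apply: fin_bigcap_measurable => // ij _.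
exact: measurable_RV_preimage.
Qed.

Lemma prob_code_fiber q : P (code @^-1` [set q]) = (mat_wt p m n q)%:E.
Proof.
have [law indep] := XP.
rewrite code_fiberE indep; last by [].
rewrite (eq_bigr (fun ij : 'I_m * 'I_(n + n) => (bern p (match fintype.split ij.2 with
    | inl j => (q ij.1 j).1 | inr j => (q ij.1 j).2 end))%:E)); last first.
  move=> [i k] _ /=; set b := match _ with inl _ => _ | inr _ => _ end.
  rewrite -[LHS]/(distribution P (X i k) [set b]) law bernoulli_probE; last first.
    by have := p01; lra.
  have mem1 (c : bool) : (c \in [set b]) = (c == b) by apply/idP/eqP; rewrite inE.
  rewrite !diracE !mem1 /unstable.onem.
  by case: b {mem1} => /=; rewrite ?mule1 ?mule0 ?adde0 ?add0e.
rewrite prodEFin; congr (_%:E).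
rewrite (eq_bigl xpredT) => [|ij]; last by rewrite inE.
rewrite -(pair_bigA _ (fun i k => bern p (match fintype.split k with
    | inl j => (q i j).1 | inr j => (q i j).2 end))) /=.
apply: eq_bigr => i _; rewrite big_split_ord /= -big_split /=; apply: eq_bigr => j _ /=.
by rewrite (unsplitK (inl j)) (unsplitK (inr j)).
Qed.

(** [code] takes finitely many values and its fibres are measurable, so every event in terms of it
    is a finite disjoint union of fibres of known mass. *)
Lemma prob_code (Q : pred {ffun 'I_m -> {ffun 'I_n -> bool * bool}}) :
  P [set w | Q (code w)] = (\sum_(q | Q q) mat_wt p m n q)%:E.
Proof.
have -> : [set w | Q (code w)] = \bigcup_(q in [set` Q]) code @^-1` [set q].
  by apply/seteqP; split=> w /= => [h|[q hq ->]]; [exists (code w)|].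
rewrite measure_fin_bigcup //; last by move=> q _; exact: measurable_code_fiber.
  rewrite -(@bigfs _ _ _ _ (index_enum _)) ?index_enum_uniq //.
    by rewrite -sumEFin; apply: eq_bigr => q _; exact: prob_code_fiber.
  by move=> q _; rewrite mem_index_enum.
by move=> q q' _ _ [w [/= <- <-]].
Qed.

Let unpair (q : {ffun 'I_m -> {ffun 'I_n -> bool * bool}}) i k : bool :=
  match fintype.split k with inl j => (q i j).1 | inr j => (q i j).2 end.

Lemma random_matrix_code w : random_matrix X w = bool_mx m n (unpair (code w)).
Proof.
apply/matrixP => i k; rewrite !mxE /unpair -{1}(splitK k).
by case: fintype.split => j /=; rewrite !ffunE.
Qed.

Lemma prob_disc_eq1 : exists2 r : R, P [set w | disc (random_matrix X w) = 1] = r%:E &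
  1 - (\sum_(q | near_count m n q == 0 :> R) mat_wt p m n q +
       \sum_(q : {ffun 'I_m -> {ffun 'I_n -> bool * bool}} | [forall i, ~~ row_odd n (q i)])
          mat_wt p m n q)
    <= r <= 1.
Proof.
have -> : [set w | disc (random_matrix X w) = 1] =
    [set w | disc (bool_mx m n (unpair (code w))) == 1 :> R].
  by apply/seteqP; split=> w /=; rewrite random_matrix_code => /eqP.
exists (\sum_(q | disc (bool_mx m n (unpair q)) == 1 :> R) mat_wt p m n q).
  exact: (prob_code (fun q => disc (bool_mx m n (unpair q)) == 1 :> R)).
have tot := sum_mat_wt p m n.
have w0 q : 0 <= mat_wt p m n q by apply: mat_wt_ge0.
apply/andP; split; last first.
  rewrite -[leRHS]tot [leRHS](bigID (fun q => disc (bool_mx m n (unpair q)) == 1 :> R)) /=.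
  by rewrite lerDl sumr_ge0.
rewrite -[X in X - _]tot lerBlDr [X in _ + (X + _)]big_mkcond [X in _ + (_ + X)]big_mkcond.
rewrite [X in _ <= X + _]big_mkcond -!big_split /=; apply: ler_sum => q _.
have pq : pair_columns m n (unpair q) = q.
  apply/ffunP => i; apply/ffunP => j; rewrite !ffunE /unpair.
  by rewrite (unsplitK (inl j)) (unsplitK (inr j)) -surjective_pairing.
have key := @disc_bool_mx_eq1 R m n (unpair q); rewrite pq in key.
have wq := w0 q.
case: eqP => d1.
  by rewrite lerDl addr_ge0 //; case: ifP.
case: eqP => n0; first by rewrite add0r lerDl; case: ifP.
case: ifP => ev; first by rewrite !add0r.
by exfalso; apply: d1; apply: key; [apply/eqP|rewrite ev].
Qed.
End BernoulliMatrix.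

(** * Asymptotics of the error terms *)

Section Asymptotics.
Context {R : realType}.

Lemma expR_sub1_le (y : R) : 0 <= y <= 2^-1 -> expR y - 1 <= 2 * y.
Proof.
move=> /andP[y0 y2].
have h : expR y * (1 - y) <= 1.
  by have := expR_ge1Dx (- y); rewrite expRN -div1r ler_pdivlMr ?expR_gt0 // mulrC.
have y1 : 0 < 1 - y by lra.
rewrite lerBlDr -(ler_pM2r y1); apply: le_trans h _; nra.
Qed.

(** Applied to y = n/m: it bounds log(n+3) by log m plus a small multiple of n/m, which matters when
    n is much larger than m log m. *)
Lemma double_le_expR (q y : R) : 0 < q -> 2 * q ^+ 2 <= y -> 2 * y <= expR (2 * y / q).
Proof.
move=> q0 yq; have y0 : 0 <= y by apply: le_trans yq; rewrite mulr_ge0 ?sqr_ge0.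
have -> : 2 * y / q = 2%:R * (y / q) by rewrite mulrA.
rewrite expRM_natl; apply: (@le_trans _ _ ((y / q) ^+ 2)).
  rewrite expr_div_n ler_pdivlMr ?exprn_gt0 //.
  have := ler_wpM2l y0 yq; lra.
rewrite lerXn2r ?nnegrE ?expR_ge0 ?divr_ge0 // ?ltW //.
by have := expR_ge1Dx (y / q); lra.
Qed.

                                                                                               
                           
Lemma unbalanced_tail_le (m n : nat) (q : R) : q = 4096 -> (0 < m)%N -> 2 * q ^+ 2 * m%:R <= n%:R ->
  q * m%:R * ln m%:R <= 2 * n%:R ->
  (n%:R + 3) ^+ (4 * m) * expR (16^-1 - n%:R / 128) <= 256 / m%:R :> R.
Proof.
move=> eq m0 mn mln.
have m0' : 0 < m%:R :> R by rewrite ltr0n.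
have q3 : 3 <= q by rewrite eq; lra.
have q0 : 0 < q by lra.
have qq : 9 <= q ^+ 2 by nra.
have m1 : 1 <= m%:R :> R by rewrite ler1n.
have mn1 : m%:R <= n%:R :> R by nra.
have n0 : 0 < n%:R :> R by lra.
have n3 : 3 <= n%:R :> R by nra.
have b1 : (n%:R + 3 : R) <= m%:R * (2 * (n%:R / m%:R)).
  by rewrite mulrCA [m%:R * _]mulrC divfK ?gt_eqF //; lra.
have b2 : 2 * (n%:R / m%:R) <= expR (2 * (n%:R / m%:R) / q).
  by apply: double_le_expR => //; rewrite ler_pdivlMr.
have b3 : n%:R + 3 <= expR (ln m%:R + 2 * (n%:R / m%:R) / q).
  rewrite expRD lnK ?posrE //; apply: le_trans b1 _.
  by rewrite ler_wpM2l // ltW.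
apply: (@le_trans _ _ (expR (ln m%:R + 2 * (n%:R / m%:R) / q) ^+ (4 * m)
    * expR (16^-1 - n%:R / 128))).
  by rewrite ler_wpM2r ?expR_ge0 // lerXn2r ?nnegrE ?expR_ge0 ?addr_ge0.
rewrite -expRM_natl -expRD natrM.
apply: (@le_trans _ _ (expR (- (n%:R / 256 - 16^-1)))).
  rewrite ler_expR.
  have -> : 4 * m%:R * (ln m%:R + 2 * (n%:R / m%:R) / q) =
      4 * (q * m%:R * ln m%:R + 2 * n%:R) / q.
    by field; rewrite !gt_eqF.
  (* With q = 4096 the right side is n/256, half of the available exponent n/128. *)
  have : 4 * (q * m%:R * ln m%:R + 2 * n%:R) / q <= 4 * (2 * n%:R + 2 * n%:R) / q.
    by rewrite ler_pM2r ?invr_gt0 // ler_pM2l // lerD2r.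
  by rewrite eq; lra.
rewrite expRN -div1r ler_pdivrMr ?expR_gt0 //.
have h := expR_ge1Dx (n%:R / 256 - 16^-1 : R).
rewrite mulrAC ler_pdivlMr // mul1r.
lra.
Qed.

Lemma disc_eq1_lower (d : measure_display) (T : measurableType d) (P : probability T R)
    (m n k : nat) (p : R) (X : 'I_m -> 'I_n -> {RV P >-> bool}) :
  0 < p <= 2^-1 -> n = (k + k)%N -> bernoulli_entries p X ->
  32 <= p * (1 - p) * k%:R -> 16 * m%:R <= k%:R :> R ->
  exists2 r : R, P [set w | disc (random_matrix X w) = 1] = r%:E &
  1 - (expR (11 * (m%:R / (p * (1 - p) * k%:R))) - 1
       + (k%:R + 3) ^+ (4 * m) * expR (16^-1 - k%:R / 128) + (3 / 4) ^+ m) <= r <= 1.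
Proof.
move=> p01 e; subst n => XP sk mk.
have [r -> /andP[r1 r2]] := prob_disc_eq1 m k p X p01 XP.
exists r => //; rewrite r2 andbT; apply: le_trans r1.
rewrite lerD2l lerN2 lerD //.
  exact: near_count_eq0_mass_bound.
exact: even_rows_mass.
Qed.

End Asymptotics.

Theorem corollary1p2 (R : realType) :
  exists C : R, 0 < C /\
    forall (n : nat -> nat) (p : nat -> R),
      (forall m : nat, ~~ odd (n m)) ->
      (forall m : nat, 0 < p (n m) <= 2^-1) ->
      (forall m : nat, C * m%:R * ln m%:R <= (n m)%:R) ->
      (fun m : nat => m%:R : R) =o_\oo (fun m : nat => (n m)%:R * p (n m)) ->
      forall (d : nat -> measure_display)
        (T : forall m : nat, measurableType (d m))
        (P : forall m : nat, probability (T m) R)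
        (X : forall m : nat, 'I_m -> 'I_(n m) -> {RV (P m) >-> bool}),
        (forall m : nat, bernoulli_entries (p (n m)) (X m)) ->
        P m [set w | disc (random_matrix (X m) w) = 1] @[m --> \oo] --> 1%E.
Proof.
have [q q4096] : exists q : R, q = 4096 by exists 4096.
have q3 : 4096 <= q by rewrite q4096.
have q0 : 0 < q by lra.
have qq0 : 0 < 8 * q ^+ 2 by rewrite mulr_gt0 // exprn_gt0.
exists q; split=> // n p n_even p01 mlogm /eqoP m_o d T P X XP.
pose k m := (n m)./2; pose s m := p (n m) * (1 - p (n m)).
have nk m : n m = (k m + k m)%N.
  by rewrite addnn -{1}(odd_double_half (n m)) (negPf (n_even m)).
(* Here np = 2kp <= 4ks since p/2 <= s, so m = o(np) becomes m = o(sk). *)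
have small (e : R) : 0 < e -> \forall m \near \oo, m%:R <= 4 * e * (s m * (k m)%:R).
  move=> e0; near=> m.
  have h : `|m%:R : R| <= e * `|(n m)%:R * p (n m)| by near: m; exact: m_o.
  have [_ ps] := variance_bounds (p (n m)) (p01 m).
  have /andP[p0 _] := p01 m.
  rewrite (ger0_norm (ler0n _ _)) ger0_norm in h; last by rewrite mulr_ge0 // ltW.
  apply: le_trans h _; rewrite {1}nk natrD.
  have k0 : 0 <= e * (k m)%:R by rewrite mulr_ge0 // ltW.
  have := ler_wpM2l k0 ps; rewrite -/(s m); lra.
apply/fine_cvgP.
have main : \forall m \near \oo, exists2 r : R,
    P m [set w | disc (random_matrix (X m) w) = 1] = r%:E &
    1 - (expR (11 * (m%:R / (s m * (k m)%:R))) - 1 + 256 / m%:R + (3 / 4) ^+ m) <= r <= 1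
    /\ m%:R / (s m * (k m)%:R) <= 22^-1.
  near=> m.
  have m0 : (0 < m)%N by near: m; exact: nbhs_infty_gt.
  have h : m%:R <= 4 * (8 * q ^+ 2)^-1 * (s m * (k m)%:R).
    by near: m; apply: small; rewrite invr_gt0.
  (* This single threshold yields sk >= 32, 16m <= k, the size condition of [unbalanced_tail_le],
     and m/(sk) <= 1/22, which puts 11m/(sk) in the range of [expR_sub1_le]. *)
  have {}h : 2 * q ^+ 2 * m%:R <= s m * (k m)%:R.
    have := ler_wpM2l (ltW qq0) h.
    have -> : 8 * q ^+ 2 * (4 * (8 * q ^+ 2)^-1 * (s m * (k m)%:R)) = 4 * (s m * (k m)%:R).
      by field; rewrite gt_eqF.
    lra.
  have m1 : 1 <= m%:R :> R by rewrite ler1n.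
  have [/andP[s0 s4] _] := variance_bounds (p (n m)) (p01 m).
  have sk : s m * (k m)%:R <= (k m)%:R by rewrite ler_piMl //; rewrite /s; lra.
  have qq : 16 <= q ^+ 2 by nra.
  have qm : 16 * m%:R <= q ^+ 2 * m%:R by rewrite ler_wpM2r.
  have sk0 : 0 < s m * (k m)%:R by lra.
  have [||r Pr /andP[r1 r2]] := disc_eq1_lower _ _ _ m _ _ _ _ (p01 m) (nk m) (XP m).
  - by rewrite -/(s m); lra.
  - by lra.
  exists r => //; split; last by rewrite ler_pdivrMr //; lra.
  rewrite r2 andbT; apply: le_trans r1; rewrite lerD2l lerN2 lerD2r lerD2l.
  apply: (unbalanced_tail_le _ _ q q4096) => //; first by lra.
  by have := mlogm m; rewrite nk natrD; lra.
split.
  by apply: filterS main => m [r -> _].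
apply/cvgrPdist_le => e e0.
(* Three error terms get e/3 each; the exponential one is at most 22 m/(sk) <= 22 * 4e' = e/3. *)
have [e' e'0 ee'] : exists2 e' : R, 0 < e' & 22 * (12 * e') = e.
  by exists (e / 22 / 12); [rewrite !divr_gt0 | field].
have [h he] : exists h : R, h * e = 768.
  by exists (768 / e); rewrite divfK // gt_eqF.
near=> m.
have [r Pr [/andP[r1 r2] eta]] : exists2 r : R,
    P m [set w | disc (random_matrix (X m) w) = 1] = r%:E &
    1 - (expR (11 * (m%:R / (s m * (k m)%:R))) - 1 + 256 / m%:R + (3 / 4) ^+ m) <= r <= 1
    /\ m%:R / (s m * (k m)%:R) <= 22^-1 by near: m.
rewrite /= Pr /= ger0_norm ?subr_ge0 //.
have m0 : 0 < m%:R :> R by rewrite ltr0n; near: m; exact: nbhs_infty_gt.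
have t1 : m%:R <= 4 * e' * (s m * (k m)%:R).
  by near: m; exact: small.
have sk0 : 0 < s m * (k m)%:R.
  have : 0 < 4 * e' * (s m * (k m)%:R) by apply: lt_le_trans t1.
  by rewrite pmulr_rgt0 // mulr_gt0.
have {}t1 : m%:R / (s m * (k m)%:R) <= 4 * e' by rewrite ler_pdivrMr.
have t0 : 0 <= m%:R / (s m * (k m)%:R) by rewrite divr_ge0 // ltW.
have t2 : expR (11 * (m%:R / (s m * (k m)%:R))) - 1 <= 22 * (m%:R / (s m * (k m)%:R)).
  move: t0 eta; move: (m%:R / _) => y; clear => y0 y1.
  have -> : 22 * y = 2 * (11 * y) by ring.
  by apply: expR_sub1_le; lra.
have t3 : 256 / m%:R <= e / 3.
  have hm : h <= m%:R by near: m; exact: nbhs_infty_ger.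
  rewrite ler_pdivrMr //; have := ler_wpM2r (ltW e0) hm; rewrite he; clear; lra.
have t4 : (3 / 4) ^+ m <= e / 3 :> R.
  near: m.
  have c34 : `|3 / 4 : R| < 1 by rewrite ger0_norm; lra.
  have /cvgrPdist_le /(_ (e / 3)) := cvg_expr c34.
  have e3 : 0 < e / 3 by apply: divr_gt0.
  move=> /(_ e3); apply: filterS => m.
  by rewrite sub0r normrN ger0_norm // exprn_ge0.
move: r1 t1 t2 t3 t4; rewrite -ee'; move: (m%:R / _) (expR _) (256 / _) ((3 / 4) ^+ m) => y E a b.
clear; lra.
Unshelve. all: by end_near.
Qed.
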